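(* Tensor Isomorphism reduces to Alternating Matrix Space Isometry with linear blow-up: there is a polynomial-time computable map sending each $\mathtt{A}\in\mathrm{T}(n\times m\times\ell,\mathbb{F})$ to an $(\ell+1)$-tuple of alternating $N\times N$ matrices over $\mathbb{F}$ with $N\le 3n+2m+2$ (depending only on $n,m$), such that $\mathtt{A}$ and $\mathtt{B}$ are isomorphic as 3-tensors if and only if the matrix spaces spanned by their image tuples are isometric.
   Context: 3-way arrays $\mathtt{A}=(a_{i,j,k})\in\mathrm{T}(n\times m\times\ell,\mathbb{F})$ are isomorphic as 3-tensors if some $(R,S,T)\in\mathrm{GL}(n,\mathbb{F})\times\mathrm{GL}(m,\mathbb{F})\times\mathrm{GL}(\ell,\mathbb{F})$ sends $\mathtt{A}$ to $\mathtt{B}$, where $(R,S,T)\cdot\mathtt{A}=\mathtt{A}'$ with $a'_{i,j,k}=\sum_{i',j',k'}r_{i,i'}s_{j,j'}t_{k,k'}a_{i',j',k'}$. A matrix $A$ is alternating if $u^tAu=0$ for all vectors $u$. Two spaces $\mathcal{A},\mathcal{B}$ of $N\times N$ matrices are isometric if there is $P\in\mathrm{GL}(N,\mathbb{F})$ with $P\mathcal{A}P^t=\mathcal{B}$. *)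

(* Defs.v *)
From HB Require Import structures.
From mathcomp Require Import all_boot all_order all_algebra.

Set Implicit Arguments.
Unset Strict Implicit.
Unset Printing Implicit Defensive.

Import GRing.Theory.
Local Open Scope ring_scope.

Definition array3 (F : fieldType) (n m l : nat) :=
  {ffun 'I_n * 'I_m * 'I_l -> F}.

Section Tensors.
Variables (F : fieldType) (n m l : nat).

Definition tensor_act (R : 'M[F]_n) (S : 'M[F]_m) (T : 'M[F]_l)
    (A : array3 F n m l) : array3 F n m l :=
  [ffun p : 'I_n * 'I_m * 'I_l =>
     \sum_(i' < n) \sum_(j' < m) \sum_(k' < l)
       R p.1.1 i' * S p.1.2 j' * T p.2 k' * A (i', j', k')].

Definition tensor_iso (A B : array3 F n m l) : Prop :=
  exists (R : 'M[F]_n) (S : 'M[F]_m) (T : 'M[F]_l),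
    [/\ R \in unitmx, S \in unitmx, T \in unitmx & tensor_act R S T A = B].

End Tensors.

Section MatrixSpaces.
Variables (F : fieldType) (N : nat).

Definition alternating (M : 'M[F]_N) : Prop :=
  forall u : 'cV[F]_N, u^T *m M *m u = 0.

Definition isometric (U V : {vspace 'M[F]_N}) : Prop :=
  exists2 P : 'M[F]_N, P \in unitmx &
    forall Y : 'M[F]_N,
      Y \in V <-> exists2 X : 'M[F]_N, X \in U & Y = P *m X *m P^T.

End MatrixSpaces.

(* Polynomial time over a field F is defined through random access machines   *)
(* with integer registers r_0, r_1, ... (constants, addition, truncated       *)
(* subtraction, comparison) and a memory M of elements of F, addressed        *)
(* through the registers (constants, field operations, zero test).  Integer   *)
(* multiplication is not a primitive, so unit cost for integer instructions   *)
(* is polynomially equivalent to bit cost.  An instruction that writes v in M *)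
(* costs 1 + sz v, where sz v is the length of the representation of v.  With *)
(* sz = 0 this counts field operations (and is ordinary polynomial time when  *)
(* F is finite); with sz the bit length it is ordinary polynomial time over,  *)
(* e.g., the rationals.                                                       *)

Definition size_measure (F : fieldType) (sz : F -> nat) : Prop :=
  exists c : nat, forall x y : F,
    [/\ (sz (x + y)%R <= c * (sz x + sz y).+1)%N,
        (sz (- x)%R <= c * (sz x).+1)%N,
        (sz (x * y)%R <= c * (sz x + sz y).+1)%N
      & (sz x^-1%R <= c * (sz x).+1)%N].

Inductive prog (F : Type) : Type :=
| Skip
| NConst of nat & nat           (* r_x := c                    *)
| NAdd of nat & nat & nat       (* r_x := r_y + r_z            *)
| NSub of nat & nat & nat       (* r_x := r_y - r_z, truncated *)
| FConst of nat & F             (* M[r_x] := a                 *)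
| FCopy of nat & nat            (* M[r_x] := M[r_y]            *)
| FAdd of nat & nat & nat       (* M[r_x] := M[r_y] + M[r_z]   *)
| FOpp of nat & nat             (* M[r_x] := - M[r_y]          *)
| FMul of nat & nat & nat       (* M[r_x] := M[r_y] * M[r_z]   *)
| FInv of nat & nat             (* M[r_x] := M[r_y]^-1         *)
| Seq of prog F & prog F
| IfLt of nat & nat & prog F & prog F     (* test r_x < r_y   *)
| IfZero of nat & prog F & prog F         (* test M[r_x] = 0  *)
| While of nat & nat & prog F.            (* while r_x < r_y  *)

Arguments Skip {F}.
Arguments NConst {F}.
Arguments NAdd {F}.
Arguments NSub {F}.
Arguments FCopy {F}.
Arguments FAdd {F}.
Arguments FOpp {F}.
Arguments FMul {F}.
Arguments FInv {F}.

Record state (F : Type) := State { nreg : nat -> nat; fmem : nat -> F }.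

Definition upd (T : Type) (g : nat -> T) (a : nat) (v : T) : nat -> T :=
  fun b => if b == a then v else g b.

Section Semantics.
Variables (F : fieldType) (sz : F -> nat).
Implicit Types (s : state F) (p q : prog F) (x y z t : nat).

Definition setr s x (v : nat) : state F := State (upd (nreg s) x v) (fmem s).
Definition setm s x (v : F) : state F :=
  State (nreg s) (upd (fmem s) (nreg s x) v).
Definition getm s x : F := fmem s (nreg s x).

(* exec p s t s': started in s, p halts in s' with total cost t. *)
Inductive exec : prog F -> state F -> nat -> state F -> Prop :=
| ExSkip s : exec Skip s 1 s
| ExNConst s x c : exec (NConst x c) s 1 (setr s x c)
| ExNAdd s x y z :
    exec (NAdd x y z) s 1 (setr s x (nreg s y + nreg s z)%N)
| ExNSub s x y z :
    exec (NSub x y z) s 1 (setr s x (nreg s y - nreg s z)%N)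
| ExFConst s x (a : F) : exec (FConst x a) s (sz a).+1 (setm s x a)
| ExFCopy s x y :
    exec (FCopy x y) s (sz (getm s y)).+1 (setm s x (getm s y))
| ExFAdd s x y z (v := getm s y + getm s z) :
    exec (FAdd x y z) s (sz v).+1 (setm s x v)
| ExFOpp s x y (v := - getm s y) :
    exec (FOpp x y) s (sz v).+1 (setm s x v)
| ExFMul s x y z (v := getm s y * getm s z) :
    exec (FMul x y z) s (sz v).+1 (setm s x v)
| ExFInv s x y (v := (getm s y)^-1) :
    exec (FInv x y) s (sz v).+1 (setm s x v)
| ExSeq p q s1 s2 s3 t1 t2 :
    exec p s1 t1 s2 -> exec q s2 t2 s3 -> exec (Seq p q) s1 (t1 + t2)%N s3
| ExIfLt x y p q s s' t :
    exec (if (nreg s x < nreg s y)%N then p else q) s t s' ->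
    exec (IfLt x y p q) s t.+1 s'
| ExIfZero x p q s s' t :
    exec (if getm s x == 0 then p else q) s t s' ->
    exec (IfZero x p q) s t.+1 s'
| ExWhileStop x y p s :
    (nreg s y <= nreg s x)%N -> exec (While x y p) s 1 s
| ExWhileStep x y p s1 s2 s3 t1 t2 :
    (nreg s1 x < nreg s1 y)%N ->
    exec p s1 t1 s2 -> exec (While x y p) s2 t2 s3 ->
    exec (While x y p) s1 (t1 + t2).+1%N s3.

(* The sizes n, m, l are in r_0, r_1, r_2 and the entries of A in row-major   *)
(* order from address 0 on; every other register and memory cell is 0.        *)
Definition init n m l (A : array3 F n m l) : state F :=
  State (nth 0%N [:: n; m; l])
        (fun a => if [pick p : 'I_n * 'I_m * 'I_l |
                        ((p.1.1 * m + p.1.2) * l + p.2)%N == a] is Some p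
                  then A p else 0).

(* The order N of the matrices is in r_0, and their entries, matrix by matrix *)
(* and in row-major order, from address r_1 on.                               *)
Definition outputs N k (X : k.-tuple 'M[F]_N) (s : state F) : Prop :=
  nreg s 0%N = N /\
  forall (h : 'I_k) (i j : 'I_N),
    fmem s (nreg s 1%N + ((h * N + i) * N + j))%N = tnth X h i j.

Definition input_size n m l (A : array3 F n m l) : nat :=
  (n + m + l + \sum_p sz (A p))%N.

Definition polytime_computable (N : nat -> nat -> nat)
    (f : forall n m l, array3 F n m l -> l.+1.-tuple 'M[F]_(N n m)) : Prop :=
  exists (p : prog F) (c d : nat),
    forall n m l (A : array3 F n m l),
      exists (t : nat) (s : state F),
        [/\ exec p (init A) t s,
            (t <= c * (input_size A).+1 ^ d)%N
          & outputs (f n m l A) s].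

End Semantics.

(* Main.v *)
Require Import Defs.
From HB Require Import structures.
From mathcomp Require Import all_boot all_order all_algebra.
From mathcomp Require Import zify ring.

Set Implicit Arguments.
Unset Strict Implicit.
Unset Printing Implicit Defensive.

Import GRing.Theory.
Local Open Scope ring_scope.

(** Let [A_1, ..., A_l] be the [n x m] slices of the tensor. Put [d = 2(n+1)],
let [J] be a symplectic matrix of order [d], and embed [F^n] as an isotropic
subspace of [F^d] by [pad]. The tensor is sent to the matrices
[[0, pad A_k], [-(pad A_k)^T, 0]] and to the gadget [G = [[J, 0], [0, 0]]].
An isometry [P] between the spans of [A] and [B] sends [G] to [c G] plus a
combination of the slices of [B], and [c <> 0] for rank reasons. As [pad] is
isotropic, a shear that fixes all the slices of [B] removes this combination,
so we may assume that [P] preserves [G] up to the scalar [c]. Then [P]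
preserves the radical of [G], i.e. it is block triangular with diagonal blocks
[a] and [e], and [X |-> a X e^T] maps the span of the [pad A_k] onto the
span of the [pad B_k]. An isomorphism of padded tensors yields one of the original tensors.

The entries of the output are copied by three nested loops. The memory above the
input is initially zero, so only the nonzero entries have to be written. *)

(** * Linear algebra: spans, unpadding and off-diagonal forms *)

Section LinearAlgebra.
Variable F : fieldType.

(** A [1 x 1] matrix equals its transpose, so [u^T Y u] and [u^T Y^T u] cancel, also in
    characteristic 2, where skew-symmetry alone would not suffice. *)
Lemma alternating_subT (N : nat) (Y : 'M[F]_N) : alternating (Y - Y^T).
Proof.
move=> u; rewrite mulmxBr mulmxBl; apply/eqP; rewrite subr_eq0; apply/eqP.
rewrite -[LHS]trmxK; apply/matrixP=> i j.
by rewrite !ord1 mxE !trmx_mul trmxK mulmxA.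
Qed.

(** The families may be linearly dependent, so a coefficient matrix [W] need not be invertible.
    Equality of ranks lets [complete_unitmx] replace it by a unit with the same action on [mx X]. *)
Lemma eq_span_unit (l a b : nat) (X Y : 'I_l -> 'M[F]_(a, b)) :
  (forall k, exists v : 'I_l -> F, Y k = \sum_j v j *: X j) ->
  (forall k, exists v : 'I_l -> F, X k = \sum_j v j *: Y j) ->
  exists2 T : 'M[F]_l, T \in unitmx & forall k, Y k = \sum_j T k j *: X j.
Proof.
pose mx (Z : 'I_l -> 'M[F]_(a, b)) := \matrix_k mxvec (Z k).
have sub (Z W : 'I_l -> 'M[F]_(a, b)) :
    (forall k, exists v : 'I_l -> F, Z k = \sum_j v j *: W j) ->
    (mx Z <= mx W)%MS.
  move=> h; apply/row_subP=> k; have [v vE] := h k.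
  apply/submxP; exists (\row_j v j).
  rewrite mulmx_sum_row rowK vE linear_sum /=.
  by apply: eq_bigr => j _; rewrite rowK mxE linearZ.
move=> /sub YX /sub XY.
have [W WE] := submxP YX.
have rk : \rank ((mx X)^T *m W^T) = \rank (mx X)^T.
  rewrite -trmx_mul -WE !mxrank_tr; apply/eqP; rewrite eqn_leq.
  by rewrite (mxrankS YX) (mxrankS XY).
have [g gu gE] := complete_unitmx rk.
exists g^T; rewrite ?unitmx_tr // => k.
have : mx Y = g^T *m mx X.
  by apply: trmx_inj; rewrite trmx_mul trmxK -gE WE trmx_mul.
move=> /(congr1 (fun M => vec_mx (row k M))).
rewrite rowK mxvecK row_mul mulmx_sum_row linear_sum /= => ->.
by apply: eq_bigr => j _; rewrite linearZ /= rowK mxvecK !mxE.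
Qed.

(* Padding tensors by zeros does not create new isomorphisms. *)
Lemma unpad_unit (l n m d : nat) (e : 'M[F]_(d, n)) (a : 'M[F]_d)
    (C B : 'I_l -> 'M[F]_(n, m)) :
  e^T *m e = 1%:M -> a \in unitmx ->
  (forall k, a *m e *m C k = e *m B k) ->
  exists2 R : 'M[F]_n, R \in unitmx & forall k, B k = R *m C k.
Proof.
move=> eTe au h.
have rke p (X : 'M[F]_(n, p)) : \rank (e *m X) = \rank X.
  apply/eqP; rewrite eqn_leq mxrankM_maxr /=.
  by rewrite -{1}[X]mul1mx -eTe -mulmxA mxrankM_maxr.
pose mC := \mxrow_k C k; pose mB := \mxrow_k B k.
have hm : a *m (e *m mC) = e *m mB.
  by rewrite !mul_mxrow; apply: eq_mxrow => k; rewrite -h mulmxA.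
have BE : mB = e^T *m a *m e *m mC.
  by rewrite -!mulmxA hm mulmxA eTe mul1mx.
(* The corner [e^T a e] need not be invertible; it preserves the rank of [mC], which suffices to
   exchange it for a unit. *)
have rk : \rank (mC^T *m (e^T *m a *m e)^T) = \rank mC^T.
  rewrite -trmx_mul -BE !mxrank_tr -rke -hm.
  by rewrite (eqmxMfull _ _) ?row_full_unit ?rke.
have [g gu gE] := complete_unitmx rk.
exists g^T; rewrite ?unitmx_tr // => k.
have : mB = g^T *m mC.
  by apply: trmx_inj; rewrite trmx_mul trmxK -gE BE trmx_mul.
by rewrite mul_mxrow => /eq_mxrowP/(_ k).
Qed.

Definition offdiag (d m : nat) (X : 'M[F]_(d, m)) : 'M[F]_(d + m) :=
  block_mx 0 X (- X^T) 0.

Lemma offdiag_is_linear (d m : nat) : linear (@offdiag d m).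
Proof.
move=> c X Y; rewrite /offdiag scale_block_mx add_block_mx !scaler0 !addr0.
by rewrite linearP /= opprD scalerN.
Qed.

HB.instance Definition _ (d m : nat) :=
  GRing.isLinear.Build F 'M[F]_(d, m) 'M[F]_(d + m) _ (@offdiag d m)
    (@offdiag_is_linear d m).

Lemma mxrank_offdiag (d m : nat) (X : 'M[F]_(d, m)) :
  (\rank (offdiag X) <= 2 * \rank X)%N.
Proof.
have -> : offdiag X = col_mx X 0 *m row_mx 0 1%:M +
                      col_mx 0 (-1%:M) *m row_mx X^T 0.
  rewrite !mul_col_row !mulmx0 !mul0mx !mulmx1 mulNmx mul1mx add_block_mx.
  by rewrite !addr0 !add0r.
apply: leq_trans (mxrank_add _ _) _; rewrite mul2n -addnn.
apply: leq_add.
  by rewrite (leq_trans (mxrankM_maxl _ _)) // rank_col_mx0.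
by rewrite (leq_trans (mxrankM_maxr _ _)) // rank_row_mx0 mxrank_tr.
Qed.

End LinearAlgebra.

(** * The alternating matrix tuple of a tensor *)

Section Gadget.
Variables (F : fieldType) (n m l : nat).
Local Notation d := (1 + n + (1 + n))%N.
Implicit Types (A B : array3 F n m l).

Definition sympl : 'M[F]_d := block_mx 0 1%:M (- 1%:M) 0.
(** The image lies in the first, Lagrangian half of [sympl]. Leaving coordinate 0 free makes the
    rank of [gadget] equal to [2n+2], above the [2n] that slices can reach. *)
Definition pad : 'M[F]_(d, n) := col_mx (col_mx 0 1%:M) 0.
Definition gadget : 'M[F]_(d + m) := block_mx sympl 0 0 0.
Definition slice A (k : 'I_l) : 'M[F]_(n, m) := \matrix_(i, j) A (i, j, k).

Definition alt_mx A (h : nat) : 'M[F]_(d + m) :=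
  if insub h is Some k then offdiag (pad *m slice A k) else gadget.
Definition alt_tuple A : l.+1.-tuple 'M[F]_(d + m) :=
  [tuple alt_mx A h | h < l.+1].

Lemma tr_sympl : sympl^T = - sympl.
Proof.
rewrite /sympl tr_block_mx opp_block_mx !linearN /= !trmx0 !trmx1.
by rewrite !oppr0 opprK.
Qed.

Lemma sympl_sqr : sympl *m sympl = - 1%:M.
Proof.
rewrite /sympl mulmx_block !mul0mx !mulmx0 !mul1mx !mulmx1 !addr0 !add0r.
by rewrite (scalar_mx_block (1 + n)) opp_block_mx !oppr0.
Qed.

Lemma sympl_unit : sympl \in unitmx.
Proof.
suff: sympl *m (- sympl) = 1%:M by case/mulmx1_unit.
by rewrite mulmxN sympl_sqr opprK.
Qed.

Lemma pad_isotropic : pad^T *m sympl *m pad = 0.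
Proof.
rewrite /pad tr_col_mx /sympl mul_row_block mul_row_col trmx0.
by rewrite !mul0mx !mulmx0 !addr0 mul0mx.
Qed.

Lemma pad_isometry : pad^T *m pad = 1%:M.
Proof.
rewrite /pad !tr_col_mx !mul_row_col !mulmx0 addr0 trmx1.
by rewrite mulmx1 add0r.
Qed.

(** Extend [R] by 1 on the free coordinate and let the inverse transpose act on the second half: the
    resulting map is symplectic. *)
Lemma pad_equivariant (R : 'M[F]_n) : R \in unitmx ->
  exists a : 'M[F]_d,
    [/\ a \in unitmx, a *m sympl *m a^T = sympl & a *m pad = pad *m R].
Proof.
move=> Ru; pose r : 'M[F]_(1 + n) := block_mx 1%:M 0 0 R.
have ru : r \in unitmx by rewrite block_diag_mx_unit unitmx1.
exists (block_mx r 0 0 (invmx r)^T); split.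
- by rewrite block_diag_mx_unit ru unitmx_tr unitmx_inv.
- rewrite tr_block_mx /sympl !mulmx_block !trmx0 trmxK.
  rewrite !(mul0mx, mulmx0, addr0, add0r).
  by rewrite mulmx1 mulmxV // mulmxN mulNmx mulmx1 -trmx_mul mulmxV ?trmx1.
rewrite /pad mul_block_col /r mul_block_col !mul_col_mx !mul0mx !mulmx0.
by rewrite !addr0 !add0r mulmx1 mul1mx.
Qed.

Lemma alternating_alt_mx A h : alternating (alt_mx A h).
Proof.
rewrite /alt_mx; case: insubP => [k _ _|_].
  have -> : offdiag (pad *m slice A k) =
      block_mx 0 (pad *m slice A k) 0 0 - (block_mx 0 (pad *m slice A k) 0 0)^T.
    rewrite tr_block_mx !trmx0 opp_block_mx add_block_mx.
    by rewrite !subr0 add0r.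
  exact: alternating_subT.
have -> : gadget = block_mx (block_mx 0 1%:M 0 0) 0 0 0 -
                   (block_mx (block_mx 0 1%:M 0 0) 0 0 0)^T.
  rewrite !tr_block_mx !trmx0 trmx1 !opp_block_mx !add_block_mx.
  by rewrite !subr0 add0r.
exact: alternating_subT.
Qed.

Lemma alt_mx_slice A (k : 'I_l) : alt_mx A k = offdiag (pad *m slice A k).
Proof. by rewrite /alt_mx valK. Qed.

Lemma alt_mx_gadget A : alt_mx A l = gadget.
Proof. by rewrite /alt_mx insubF ?ltnn. Qed.

Lemma mem_alt_tuple A (Y : 'M[F]_(d + m)) :
  Y \in <<alt_tuple A>>%VS <-> exists (c : F) (v : 'I_l -> F),
    Y = c *: gadget + offdiag (pad *m \sum_k v k *: slice A k).
Proof.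
split=> [/coord_span ->|[c [v ->]]].
  exists (coord (alt_tuple A) ord_max Y).
  exists (fun k => coord (alt_tuple A) (widen_ord (leqnSn l) k) Y).
  have nthE (h : 'I_l.+1) : (alt_tuple A)`_h = alt_mx A h.
    by rewrite -tnth_nth tnth_mktuple.
  rewrite big_ord_recr addrC nthE alt_mx_gadget.
  congr (_ + _); rewrite mulmx_sumr linear_sum /=; apply: eq_bigr => k _.
  by rewrite (nthE (widen_ord _ k)) alt_mx_slice -scalemxAr linearZ.
have mem (h : 'I_l.+1) : alt_mx A h \in <<alt_tuple A>>%VS.
  rewrite -(tnth_mktuple (fun h : 'I_l.+1 => alt_mx A h)).
  by rewrite memv_span ?mem_tnth.
apply: memvD; first by have := mem ord_max; rewrite alt_mx_gadget; apply: memvZ.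
rewrite mulmx_sumr linear_sum; apply: memv_suml => k _ /=.
rewrite -scalemxAr linearZ /= -alt_mx_slice; apply: memvZ.
exact: mem (widen_ord (leqnSn l) k).
Qed.

Lemma slice_tensor_act (R : 'M[F]_n) (S : 'M[F]_m) (T : 'M[F]_l) A k :
  slice (tensor_act R S T A) k = \sum_j T k j *: (R *m slice A j *m S^T).
Proof.
apply/matrixP=> i j; rewrite !mxE ffunE summxE /=.
under eq_bigr => i' _ do rewrite exchange_big.
rewrite exchange_big /=; apply: eq_bigr => k' _; rewrite !mxE.
under [in RHS]eq_bigr => j' _ do rewrite !mxE mulr_suml.
rewrite exchange_big mulr_sumr; apply: eq_bigr => i' _.
rewrite mulr_sumr; apply: eq_bigr => j' _; rewrite !mxE.
ring.
Qed.

Lemma slice_inj A B : (forall k, slice A k = slice B k) -> A = B.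
Proof.
move=> h; apply/ffunP=> -[[i j] k].
by have /matrixP/(_ i j) := h k; rewrite !mxE.
Qed.

Lemma mulmx_diag_gadget (a : 'M[F]_d) (b : 'M[F]_(d, m)) (e : 'M[F]_m) :
  block_mx a b 0 e *m gadget *m (block_mx a b 0 e)^T =
  block_mx (a *m sympl *m a^T) 0 0 0.
Proof.
rewrite tr_block_mx trmx0 !mulmx_block.
by rewrite !(mul0mx, mulmx0, addr0, add0r).
Qed.

(** [b] enters only the top-left block, so the converse direction can read off [X |-> a X e^T] from
    the top-right block. *)
Lemma mulmx_diag_offdiag (a : 'M[F]_d) (b : 'M[F]_(d, m)) (e : 'M[F]_m)
    (X : 'M[F]_(d, m)) :
  block_mx a b 0 e *m offdiag X *m (block_mx a b 0 e)^T =
  block_mx (a *m X *m b^T - b *m X^T *m a^T) (a *m X *m e^T)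
    (- (a *m X *m e^T)^T) 0.
Proof.
rewrite tr_block_mx trmx0 /offdiag !mulmx_block.
rewrite !(mul0mx, mulmx0, addr0, add0r) !trmx_mul trmxK !mulmxN !mulNmx mulmxA.
by rewrite addrC.
Qed.

(** * From tensor isomorphism to isometry *)

(** The block diagonal matrix of [S] and the symplectic extension of [R] fixes the gadget, while [T]
    merely changes the spanning family of slices. *)
Lemma tensor_iso_isometric A B :
  tensor_iso A B -> isometric <<alt_tuple A>>%VS <<alt_tuple B>>%VS.
Proof.
case=> R [S [T [Ru Su Tu AB]]].
have [a [au aJ aP]] := pad_equivariant Ru.
pose P := block_mx a 0 0 S.
have PE c (X : 'M[F]_(n, m)) :
    P *m (c *: gadget + offdiag (pad *m X)) *m P^T =
    c *: gadget + offdiag (pad *m (R *m X *m S^T)).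
  rewrite mulmxDr mulmxDl -scalemxAr -scalemxAl mulmx_diag_gadget aJ.
  rewrite mulmx_diag_offdiag trmx0 mulmx0 !mul0mx subrr.
  by rewrite /offdiag !mulmxA aP.
have BE w : \sum_k w k *: slice B k =
    R *m (\sum_j (\sum_k w k * T k j) *: slice A j) *m S^T.
  rewrite -AB mulmx_sumr mulmx_suml.
  under eq_bigr => k _ do rewrite slice_tensor_act scaler_sumr.
  rewrite exchange_big /=; apply: eq_bigr => j _.
  rewrite -scalemxAr -scalemxAl scaler_suml.
  by apply: eq_bigr => k _; rewrite scalerA.
exists P; first by rewrite block_diag_mx_unit au.
move=> Y; split.
  move=> /mem_alt_tuple [c [w ->]].
  exists (c *: gadget + offdiag (pad *m
            \sum_j (\sum_k w k * T k j) *: slice A j)).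
    by apply/mem_alt_tuple; exists c, (fun j => \sum_k w k * T k j).
  by rewrite PE BE.
case=> X /mem_alt_tuple [c [v ->]] ->; apply/mem_alt_tuple.
(* Slices of [B] arise from those of [A] through [T], so coefficients pass from [A] to [B] by
   [invmx T]. *)
pose u := (\row_j v j) *m invmx T; exists c, (fun k => u 0 k).
have uT j : \sum_k u 0 k * T k j = v j.
  have := congr1 (fun M : 'rV[F]_l => M 0 j) (mulmxKV Tu (\row_j v j)).
  by rewrite [in RHS]mxE => <-; rewrite mxE.
by rewrite PE BE; under [in RHS]eq_bigr => j _ do rewrite uT.
Qed.

(** * From isometry to tensor isomorphism *)

Lemma isometry_normalize A B :
  isometric <<alt_tuple A>>%VS <<alt_tuple B>>%VS ->
  exists (c : F) (P : 'M[F]_(d + m)),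
    [/\ c != 0, P \in unitmx, P *m gadget *m P^T = c *: gadget
      & forall Y, Y \in <<alt_tuple B>>%VS <->
          exists2 X, X \in <<alt_tuple A>>%VS & Y = P *m X *m P^T].
Proof.
case=> P Pu PE.
have [c [v GE]] : exists (c : F) (v : 'I_l -> F), P *m gadget *m P^T =
    c *: gadget + offdiag (pad *m \sum_k v k *: slice B k).
  apply/mem_alt_tuple/PE; exists gadget => //; apply/mem_alt_tuple.
  exists 1, (fun=> 0); rewrite scale1r big1 ?mulmx0 ?linear0 ?addr0 // => k _.
  exact: scale0r.
set w := \sum_k _ in GE.
(* The gadget has rank 2n+2, whereas the slices only have rank at most 2n. *)
have cn0 : c != 0.
  apply/eqP=> c0; move: GE; rewrite c0 scale0r add0r => GE.
  have rk_le : (\rank gadget <= 2 * n)%N.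
    have -> : gadget = invmx P *m offdiag (pad *m w) *m invmx P^T.
      by rewrite -GE -!mulmxA mulmxV ?unitmx_tr // mulmx1 mulKmx.
    apply: leq_trans (mxrankM_maxl _ _) (leq_trans (mxrankM_maxr _ _) _).
    apply: leq_trans (mxrank_offdiag _) _.
    by rewrite leq_mul2l /= (leq_trans (mxrankM_maxr _ _)) ?rank_leq_row.
  have rk_ge : (d <= \rank gadget)%N.
    rewrite -{1}(mxrank_unit sympl_unit).
    have -> : sympl = row_mx 1%:M 0 *m gadget *m col_mx 1%:M 0.
      rewrite /gadget mul_row_block mul_row_col.
      by rewrite !(mul0mx, mulmx0, addr0) mul1mx mulmx1.
    exact: leq_trans (mxrankM_maxl _ _) (mxrankM_maxr _ _).
  have := leq_trans rk_ge rk_le; clear; lia.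
(* The shear [Q] clears the slice part of [P G P^T]; it fixes all slices      *)
(* because the image of [pad] is isotropic.                                   *)
pose Z : 'M[F]_(m, d) := - c^-1 *: (w^T *m pad^T *m sympl).
pose Q : 'M[F]_(d + m) := block_mx 1%:M 0 Z 1%:M.
have ZP (X : 'M[F]_(n, m)) : Z *m (pad *m X) = 0.
  rewrite -scalemxAl -!mulmxA [sympl *m _]mulmxA [pad^T *m _]mulmxA.
  by rewrite [pad^T *m _]mulmxA pad_isotropic mul0mx mulmx0 scaler0.
(* [sympl] squares to -1, which absorbs the sign in [Z]; the factor [c^-1] matches the gadget
   coefficient of [P G P^T]. *)
have ZJ : Z *m sympl = c^-1 *: (pad *m w)^T.
  rewrite /Z -scalemxAl -(mulmxA _ sympl) sympl_sqr.
  by rewrite mulmxN mulmx1 scalerN scaleNr opprK trmx_mul.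
have JZ : sympl *m Z^T = - (c^-1 *: (pad *m w)).
  apply: trmx_inj; rewrite [LHS]trmx_mul trmxK tr_sympl mulmxN ZJ.
  by rewrite [RHS]linearN /=; congr (- _); rewrite linearZ.
have Qu : Q \in unitmx by rewrite unitmxE det_lblock !det1 mulr1 unitr1.
have QO (X : 'M[F]_(n, m)) :
    Q *m offdiag (pad *m X) *m Q^T = offdiag (pad *m X).
  rewrite tr_block_mx !trmx1 trmx0 /offdiag !mulmx_block.
  rewrite !(mul0mx, mulmx0, addr0, add0r, mul1mx, mulmx1) ZP addr0.
  by rewrite mulNmx -trmx_mul ZP trmx0 oppr0.
have QG : Q *m gadget *m Q^T = gadget - c^-1 *: offdiag (pad *m w).
  rewrite tr_block_mx !trmx1 trmx0 /gadget /offdiag !mulmx_block.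
  rewrite !(mul0mx, mulmx0, addr0, add0r, mul1mx, mulmx1).
  rewrite scale_block_mx opp_block_mx add_block_mx ZJ JZ -scalemxAl.
  rewrite -trmx_mul ZP trmx0 !scaler0 !subr0 !add0r.
  by rewrite scalerN opprK.
have QE c' (X : 'M[F]_(n, m)) :
    Q *m (c' *: gadget + offdiag (pad *m X)) *m Q^T =
    c' *: gadget + offdiag (pad *m (X - (c' / c) *: w)).
  have -> : offdiag (pad *m (X - (c' / c) *: w)) =
      offdiag (pad *m X) - (c' / c) *: offdiag (pad *m w).
    by rewrite mulmxBr -scalemxAr linearB; congr (_ - _); apply: linearZ.
  rewrite mulmxDr mulmxDl QO -scalemxAr -scalemxAl QG scalerBr scalerA -addrA.
  by rewrite [- _ + _]addrC.
exists c, (Q *m P); split => //.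
- by rewrite unitmx_mul Qu.
- have -> : Q *m P *m gadget *m (Q *m P)^T = Q *m (P *m gadget *m P^T) *m Q^T.
    by rewrite trmx_mul !mulmxA.
  by rewrite GE QE divff // scale1r subrr mulmx0 linear0 addr0.
have PQ (X : 'M[F]_(d + m)) :
    Q *m P *m X *m (Q *m P)^T = Q *m (P *m X *m P^T) *m Q^T.
  by rewrite trmx_mul !mulmxA.
(* [w] is a combination of slices of [B], hence the shift by multiples of [w] in [QE] stays inside
   the span of [alt_tuple B]. *)
have shift c' (u : 'I_l -> F) : \sum_k u k *: slice B k + c' *: w =
    \sum_k (u k + c' * v k) *: slice B k.
  rewrite scaler_sumr -big_split; apply: eq_bigr => k _ /=.
  by rewrite scalerA scalerDl.
move=> Y; split.
  move=> /mem_alt_tuple [c' [u ->]].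
  have /PE [X XA XE] :
      c' *: gadget + offdiag (pad *m (\sum_k u k *: slice B k + (c' / c) *: w))
      \in <<alt_tuple B>>%VS.
    by rewrite shift; apply/mem_alt_tuple; eexists; eexists.
  by exists X; rewrite ?PQ -?XE ?QE ?addrK.
case=> X XA ->; rewrite PQ.
have /PE/mem_alt_tuple [c' [u ->]] :
  exists2 X', X' \in <<alt_tuple A>>%VS & P *m X *m P^T = P *m X' *m P^T.
  by exists X.
rewrite QE -scaleNr shift.
by apply/mem_alt_tuple; eexists; eexists.
Qed.

Lemma isometric_tensor_iso A B :
  isometric <<alt_tuple A>>%VS <<alt_tuple B>>%VS -> tensor_iso A B.
Proof.
case/isometry_normalize=> c [P [cn0 Pu PG PE]].
move: PG PE Pu; rewrite -[P]submxK.
set a := ulsubmx P; set b := ursubmx P; set g := dlsubmx P; set e := drsubmx P.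
move=> PG PE Pu.
(* Comparing blocks in [P G P^T = c G]: the corner makes [a] invertible, and then [g J a^T = 0]
   forces [g = 0]. *)
have /eq_block_mx [aJ _ ga _] : block_mx (a *m sympl *m a^T)
    (a *m sympl *m g^T) (g *m sympl *m a^T) (g *m sympl *m g^T) =
    block_mx (c *: sympl) 0 0 0.
  have -> : block_mx (c *: sympl) 0 0 0 = c *: gadget.
    by rewrite (scale_block_mx c sympl) !scaler0.
  rewrite -PG.
  rewrite tr_block_mx !mulmx_block.
  by rewrite !(mul0mx, mulmx0, addr0).
have au : a \in unitmx.
  have : c *: sympl \in unitmx by rewrite unitmxZ ?unitfE // sympl_unit.
  by rewrite -aJ !unitmx_mul => /andP [/andP []].
have g0 : g = 0.
  move/(congr1 (mulmxr (invmx a^T))): ga.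
  rewrite /= mul0mx mulmxK ?unitmx_tr //.
  move/(congr1 (mulmxr (invmx sympl))).
  by rewrite /= mul0mx mulmxK ?sympl_unit.
move: PE Pu; rewrite {}g0 {PG ga g} unitmxE det_ublock unitrM -!unitmxE.
move=> PE /andP [_ eu].
have topright c1 c2 (X Y : 'M[F]_(n, m)) :
    c2 *: gadget + offdiag (pad *m Y) = block_mx a b 0 e *m
      (c1 *: gadget + offdiag (pad *m X)) *m (block_mx a b 0 e)^T ->
    pad *m Y = a *m (pad *m X) *m e^T.
  rewrite mulmxDr mulmxDl -scalemxAr -scalemxAl mulmx_diag_gadget.
  rewrite mulmx_diag_offdiag !scale_block_mx !add_block_mx.
  by case/eq_block_mx=> _; rewrite !scaler0 !add0r.
pose X k := a *m (pad *m slice A k) *m e^T.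
have XE (v : 'I_l -> F) :
    a *m (pad *m \sum_k v k *: slice A k) *m e^T = \sum_k v k *: X k.
  rewrite !mulmx_sumr mulmx_suml; apply: eq_bigr => k _.
  by rewrite -!scalemxAr -scalemxAl.
have sliceE C k : slice C k = \sum_j (j == k)%:R *: slice C j.
  rewrite (bigD1 k) //= eqxx scale1r big1 ?addr0 // => j /negPf ->.
  exact: scale0r.
(* The two families have the same span: pull slices of [B] back along the isometry, push those of
   [A] forward, and compare top-right blocks. *)
have [T Tu TE] : exists2 T : 'M[F]_l, T \in unitmx &
    forall k, pad *m slice B k = \sum_j T k j *: X j.
  apply: eq_span_unit => k.
    have /PE [_ /mem_alt_tuple [c' [v ->]] /topright YE] :
        0 *: gadget + offdiag (pad *m slice B k) \in <<alt_tuple B>>%VS.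
      by rewrite sliceE; apply/mem_alt_tuple; eexists; eexists.
    by exists v; rewrite YE XE.
  have AE : 0 *: gadget + offdiag (pad *m slice A k) \in <<alt_tuple A>>%VS.
    by rewrite sliceE; apply/mem_alt_tuple; eexists; eexists.
  have [|c' [v YE]] := (mem_alt_tuple B (block_mx a b 0 e *m
    (0 *: gadget + offdiag (pad *m slice A k)) *m (block_mx a b 0 e)^T)).1.
    by apply/PE; eexists; first exact: AE.
  exists v; rewrite /X -(topright _ _ _ _ (esym YE)) mulmx_sumr.
  by apply: eq_bigr => j _; rewrite scalemxAr.
(* [T] and [e] are absorbed into [C], so that only left multiplication by [a] remains for
   [unpad_unit] to cut down to [R]. *)
pose C k : 'M[F]_(n, m) := (\sum_j T k j *: slice A j) *m e^T.
have CE k : a *m pad *m C k = pad *m slice B k.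
  by rewrite TE -XE /C !mulmxA.
have [R Ru RE] := unpad_unit pad_isometry au CE.
exists R, e, T; split => //; apply: slice_inj => k.
rewrite slice_tensor_act RE /C mulmx_suml mulmx_sumr.
by apply: eq_bigr => j _; rewrite -scalemxAl -scalemxAr mulmxA.
Qed.

End Gadget.

(** * Program logic with cost bounds *)

Section Programs.
Variables (F : fieldType) (sz : F -> nat).
Implicit Types (L : seq nat) (M : nat -> F) (p q : prog F).
Implicit Type Q : seq nat -> (nat -> F) -> Prop.

(* Started with registers [nth 0 L] and memory [M], [p] halts within cost [K] *)
(* in a state that is described by some [L'] and [M'] with [Q L' M'].         *)
Definition runs p L M (K : nat) Q : Prop :=
  forall s, nreg s =1 nth 0%N L -> fmem s = M ->
  exists t s' L', [/\ exec sz p s t s', (t <= K)%N,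
    nreg s' =1 nth 0%N L' & Q L' (fmem s')].

Lemma runs_weaken p L M (K K' : nat) Q :
  (K <= K')%N -> runs p L M K Q -> runs p L M K' Q.
Proof.
move=> KK' h s sL sM; have [t [s' [L' [ex tK s'L Qs']]]] := h s sL sM.
by exists t, s', L'; split=> //; apply: leq_trans KK'.
Qed.

Lemma upd_set_nth (g : nat -> nat) L x v :
  g =1 nth 0%N L -> upd g x v =1 nth 0%N (set_nth 0%N L x v).
Proof. by move=> gL y; rewrite nth_set_nth /= /upd gL. Qed.

Lemma runs_nconst x c L M Q :
  Q (set_nth 0%N L x c) M -> runs (NConst x c) L M 1 Q.
Proof.
move=> h s sL sM; exists 1%N, (setr s x c), (set_nth 0%N L x c).
by rewrite /= sM; split=> //; [constructor | apply: upd_set_nth].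
Qed.

Lemma runs_nadd x y z L M Q :
  Q (set_nth 0%N L x (nth 0 L y + nth 0 L z))%N M -> runs (NAdd x y z) L M 1 Q.
Proof.
move=> h s sL sM; exists 1%N, (setr s x (nreg s y + nreg s z)).
exists (set_nth 0%N L x (nth 0 L y + nth 0 L z))%N.
rewrite /= sM; split=> //; first by constructor.
by rewrite !sL; apply: upd_set_nth.
Qed.

Lemma runs_fconst x a L M (w : nat) Q :
  (sz a <= w)%N -> Q L (upd M (nth 0%N L x) a) -> runs (FConst x a) L M w.+1 Q.
Proof.
move=> aw h s sL sM; exists (sz a).+1, (setm s x a), L.
by rewrite /= sM sL; split=> //; constructor.
Qed.

Lemma runs_fcopy x y L M (w : nat) Q (a := M (nth 0%N L y)) :
  (sz a <= w)%N -> Q L (upd M (nth 0%N L x) a) -> runs (FCopy x y) L M w.+1 Q.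
Proof.
move=> aw h s sL sM; exists (sz (getm s y)).+1, (setm s x (getm s y)), L.
by rewrite /= /getm !sL sM; split=> //; rewrite -sM -!sL; constructor.
Qed.

Lemma runs_fopp x y L M (w : nat) Q (a := - M (nth 0%N L y)) :
  (sz a <= w)%N -> Q L (upd M (nth 0%N L x) a) -> runs (FOpp x y) L M w.+1 Q.
Proof.
move=> aw h s sL sM; exists (sz (- getm s y)).+1, (setm s x (- getm s y)), L.
by rewrite /= /getm !sL sM; split=> //; rewrite -sM -!sL; constructor.
Qed.

Lemma runs_seq p q L M (K1 K2 : nat) Q :
  runs p L M K1 (fun L' M' => runs q L' M' K2 Q) ->
  runs (Seq p q) L M (K1 + K2) Q.
Proof.
move=> h s sL sM; have [t1 [s1 [L1 [ex1 tK1 s1L h1]]]] := h s sL sM.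
have [t2 [s2 [L2 [ex2 tK2 s2L h2]]]] := h1 s1 s1L erefl.
exists (t1 + t2)%N, s2, L2; split=> //; last exact: leq_add.
exact: ExSeq ex1 ex2.
Qed.

(** The invariant is indexed by the counter and keeps the bound constant, so there are [n] rounds.
    Each costs the body plus one test; the last, failing test gives the outer successor. *)
Lemma runs_while x y p (I : nat -> seq nat -> (nat -> F) -> Prop) (n K : nat)
    L M Q :
  (forall i L' M', I i L' M' -> nth 0%N L' x = i /\ nth 0%N L' y = n) ->
  I 0%N L M ->
  (forall i L' M', (i < n)%N -> I i L' M' -> runs p L' M' K (I i.+1)) ->
  (forall L' M', I n L' M' -> Q L' M') ->
  runs (While x y p) L M (n * K.+1).+1 Q.
Proof.
move=> Lxy I0 step final.
suff: forall k i L' M', (i + k = n)%N -> I i L' M' ->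
    runs (While x y p) L' M' (k * K.+1).+1 Q by move=> h; apply: (h n 0%N).
elim=> [|k IHk] i L' M' ikn Ii s sL sM.
  have [xE yE] := Lxy _ _ _ Ii; rewrite addn0 in ikn; rewrite {}ikn in xE Ii.
  exists 1%N, s, L'; split=> //; last by rewrite sM; apply: final.
  by constructor; rewrite !sL xE yE.
have [xE yE] := Lxy _ _ _ Ii.
have ltin : (i < n)%N by rewrite -ikn -addSnnS leq_addr.
have [t1 [s1 [L1 [ex1 tK1 s1L I1]]]] := step i L' M' ltin Ii s sL sM.
have [|t2 [s2 [L2 [ex2 tK2 s2L h2]]]] := IHk i.+1 _ _ _ I1 s1 s1L erefl.
  by rewrite addSnnS.
exists (t1 + t2).+1, s2, L2; split=> //.
  by apply: ExWhileStep ex1 ex2; rewrite !sL xE yE.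
by rewrite ltnS mulSn addSn -addnS leq_add.
Qed.

(** * The program *)

(* r_x := r_y * r_z, provided that r_x = r_c = 0 and r_3 = 1 initially. *)
Definition mul_prog x y z c : prog F :=
  While c z (Seq (NAdd x x y) (NAdd c c 3)).

(** Loops follow the storage order [i], [j], [k] of the input, so [r_13] moves by 1. In the output a
    step in [k] skips a matrix; a step in [j] or [i] moves by 1 or [N] above the diagonal, by [N] or
    1 below it. *)
Definition copy_entry : prog F :=
  Seq (FCopy 21 13) (Seq (FOpp 22 13) (Seq (NAdd 21 21 7) (Seq (NAdd 22 22 7)
    (Seq (NAdd 13 13 3) (NAdd 20 20 3))))).

Definition copy_tube : prog F :=
  Seq (NConst 20 0) (Seq (NAdd 21 18 23) (Seq (NAdd 22 19 23)
    (Seq (While 20 2 copy_entry) (Seq (NAdd 18 18 3) (Seq (NAdd 19 19 6)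
      (NAdd 17 17 3)))))).

Definition copy_slab : prog F :=
  Seq (NConst 17 0) (Seq (NAdd 18 15 23) (Seq (NAdd 19 16 23)
    (Seq (While 17 1 copy_tube) (Seq (NAdd 15 15 6) (Seq (NAdd 16 16 3)
      (NAdd 14 14 3)))))).

Definition gadget_entry : prog F :=
  Seq (FConst 25 1) (Seq (FConst 26 (- 1)) (Seq (NAdd 25 25 27)
    (Seq (NAdd 26 26 27) (NAdd 24 24 3)))).

(* r_4 = n+1, r_5 = 2(n+1), r_6 = N, r_7 = N^2, r_9 = l N^2, r_11 = (n+1) N;  *)
(* r_13 scans the input; r_15, r_18, r_21 (resp. r_16, r_19, r_22) address    *)
(* the entry above (resp. below) the diagonal in the output, where the base   *)
(* address is r_9; r_25 and r_26 do so for the gadget; r_23 stays 0.          *)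
Definition header_prog : prog F :=
  Seq (NConst 3 1) (Seq (NAdd 4 3 0) (Seq (NAdd 5 4 4) (Seq (NAdd 6 5 1)
  (Seq (mul_prog 7 6 6 8) (Seq (mul_prog 9 7 2 10) (mul_prog 11 6 4 12)))))).

(** The start addresses are row 1, column [d] and row [d], column 1 of the first matrix; index 0 is
    the coordinate that [pad] leaves free. *)
Definition slices_prog : prog F :=
  Seq (NAdd 15 9 6) (Seq (NAdd 15 15 5)
  (Seq (NAdd 16 9 11) (Seq (NAdd 16 16 11) (Seq (NAdd 16 16 3)
  (While 14 0 copy_slab))))).

(** [r_9] is added twice, as base address and as offset of the last matrix, both being [l N^2]. The
    stride [N + 1] in [r_27] follows the diagonals of the identity blocks. *)
Definition gadget_prog : prog F :=
  Seq (NAdd 25 9 9) (Seq (NAdd 26 25 11) (Seq (NAdd 25 25 4)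
  (Seq (NAdd 27 6 3) (Seq (While 24 4 gadget_entry)
  (Seq (NAdd 0 6 23) (NAdd 1 9 23)))))).

Definition alt_prog : prog F := Seq header_prog (Seq slices_prog gadget_prog).

Ltac step :=
  first [ apply: runs_nadd; rewrite /=
        | apply: runs_nconst; rewrite /=
        | apply: runs_seq ].
Ltac regs_eq := do ?[congr cons; try done; try lia].

(** * Running the program *)

Section Registers.
Variables (n m l n1 d N NN base w : nat).

Definition header_regs (r : seq nat) : seq nat :=
  [:: n, m, l, 1, n1, d, N, NN, N, base, l, (n1 * N), n1 & r]%N.

Lemma runs_header (M : nat -> F) Q :
  n1 = n.+1 -> d = (n1 + n1)%N -> N = (d + m)%N -> NN = (N * N)%N ->
  base = (l * NN)%N ->
  Q (header_regs (nseq 15 0%N)) M ->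
  runs header_prog ([:: n; m; l] ++ nseq 25 0%N) M (10 + 3 * (N + l + n1)) Q.
Proof.
move=> n1E dE NE NNE baseE h.
apply: (@runs_weaken _ _ _ (1 + (1 + (1 + (1 +
  ((N * (1 + 1).+1).+1 + ((l * (1 + 1).+1).+1 +
    (n1 * (1 + 1).+1).+1)))))))%N; first by lia.
rewrite /header_prog; do 9!step.
apply: (@runs_while _ _ _ (fun i L' M' =>
    L' = [:: n, m, l, 1, n1, d, N, i * N, i & nseq 19 0]%N /\ M' = M)).
- by move=> i ? ? [->].
- by split=> //; regs_eq.
- by move=> i ? ? _ [-> ->]; do 3!step; split=> //; regs_eq.
move=> ? ? [-> ->]; step.
apply: (@runs_while _ _ _ (fun i L' M' =>
    L' = [:: n, m, l, 1, n1, d, N, NN, N, i * NN, i & nseq 17 0]%N /\ M' = M)).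
- by move=> i ? ? [->].
- by split=> //; regs_eq.
- by move=> i ? ? _ [-> ->]; do 3!step; split=> //; regs_eq.
move=> ? ? [-> ->].
apply: (@runs_while _ _ _ (fun i L' M' =>
    L' = [:: n, m, l, 1, n1, d, N, NN, N, base, l, i * N, i & nseq 15 0]%N /\
    M' = M)).
- by move=> i ? ? [->].
- by split=> //; regs_eq.
- by move=> i ? ? _ [-> ->]; do 3!step; split=> //; regs_eq.
by move=> ? ? [-> ->].
Qed.

Definition slices_regs (src i p1 p2 : nat) (r : seq nat) : seq nat :=
  header_regs ([:: src, i, p1, p2 & r] ++ nseq 5 0%N).

Definition upper_addr i j k := (base + ((k * N + (1 + i)) * N + (d + j)))%N.
Definition lower_addr i j k := (base + ((k * N + (d + j)) * N + (1 + i)))%N.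

(** [I a M] is meant to say that the first [a] input entries are copied; kept abstract, it separates
    control flow and cost from memory contents. Cell [a] is read again in [M'] because the negated
    copy is made after the first write. *)
Variable I : nat -> (nat -> F) -> Prop.
Hypothesis copy_step : forall i j k (a := ((i * m + j) * l + k)%N) M,
  (i < n)%N -> (j < m)%N -> (k < l)%N -> I a M ->
  let M' := upd M (upper_addr i j k) (M a) in
  [/\ (sz (M a) <= w)%N, (sz (- M' a) <= w)%N
    & I a.+1 (upd M' (lower_addr i j k) (- M' a))].

Hypothesis NNE : NN = (N * N)%N.

Lemma runs_tube i j M k0 t1 t2 (u1 := upper_addr i j 0) (u2 := lower_addr i j 0)
  (p1 p2 : nat) : (i < n)%N -> (j < m)%N ->
  I ((i * m + j) * l)%N M ->
  runs copy_tube
    (slices_regs ((i * m + j) * l) i p1 p2 [:: j; u1; u2; k0; t1; t2]) M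
    (7 + l * (7 + 2 * w))
    (fun L' M' => I ((i * m + j.+1) * l)%N M' /\ exists k0 t1 t2,
      L' = slices_regs ((i * m + j.+1) * l) i p1 p2
        [:: j.+1; upper_addr i j.+1 0; lower_addr i j.+1 0; k0; t1; t2]).
Proof.
move=> ltin ltjm I0; rewrite /slices_regs /header_regs.
apply: (@runs_weaken _ _ _ (1 + (1 + (1 + ((l * (w.+1 + (w.+1 + (1 + (1 +
  (1 + 1))))).+1).+1 + (1 + (1 + 1))))))%N); first by lia.
rewrite /copy_tube; do 7!step.
apply: (@runs_while _ _ _ (fun k L' M' => I ((i * m + j) * l + k)%N M' /\
  L' = slices_regs ((i * m + j) * l + k) i p1 p2
        [:: j; u1; u2; k; upper_addr i j k; lower_addr i j k])).
- by move=> k ? ? [_ ->].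
- rewrite addn0; split=> //.
  by rewrite /slices_regs /header_regs /=; regs_eq.
- move=> k ? M' ltkl [Ik ->].
  have [szc szo I'] := copy_step ltin ltjm ltkl Ik.
  rewrite /copy_entry; step; apply: runs_fcopy => //=.
  step; apply: runs_fopp => //=; do 7!step.
  rewrite addnS; split=> //.
  rewrite /slices_regs /header_regs /=; regs_eq.
    by rewrite /upper_addr; lia.
  by rewrite /lower_addr; lia.
move=> ? M' [Il ->]; do 5!step.
have -> : ((i * m + j.+1) * l = (i * m + j) * l + l)%N by lia.
split=> //; exists l, (upper_addr i j l), (lower_addr i j l).
rewrite /slices_regs /header_regs /=; regs_eq.
  by rewrite /u1 /upper_addr; lia.
by rewrite /u2 /lower_addr; lia.
Qed.

Lemma runs_slab i M (j0 q1 q2 k0 t1 t2 : nat) : (i < n)%N ->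
  I (i * m * l)%N M ->
  runs copy_slab
    (slices_regs (i * m * l) i (upper_addr i 0 0) (lower_addr i 0 0)
       [:: j0; q1; q2; k0; t1; t2]) M
    (7 + m * (8 + l * (7 + 2 * w)))
    (fun L' M' => I (i.+1 * m * l)%N M' /\ exists j0 q1 q2 k0 t1 t2 : nat,
      L' = slices_regs (i.+1 * m * l) i.+1 (upper_addr i.+1 0 0)
             (lower_addr i.+1 0 0) [:: j0; q1; q2; k0; t1; t2]).
Proof.
move=> ltin I0; rewrite /slices_regs /header_regs.
apply: (@runs_weaken _ _ _ (1 + (1 + (1 + ((m * (7 + l * (7 + 2 * w)).+1).+1 +
  (1 + (1 + 1))))))%N); first by lia.
rewrite /copy_slab; do 7!step.
apply: (@runs_while _ _ _ (fun j L' M' => I ((i * m + j) * l)%N M' /\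
  exists k0 t1 t2, L' = slices_regs ((i * m + j) * l) i (upper_addr i 0 0)
    (lower_addr i 0 0) [:: j; upper_addr i j 0; lower_addr i j 0; k0; t1; t2])).
- by move=> j ? ? [_ [? [? [? ->]]]].
- rewrite addn0; split=> //; exists k0, t1, t2.
  by rewrite /slices_regs /header_regs /=; regs_eq.
- by move=> j ? M' ltjm [Ij [? [? [? ->]]]]; apply: runs_tube.
move=> ? M' [Im [k1 [t1' [t2' ->]]]]; do 5!step.
have -> : (i.+1 * m * l = (i * m + m) * l)%N by lia.
split=> //; exists m, (upper_addr i m 0), (lower_addr i m 0), k1, t1', t2'.
rewrite /slices_regs /header_regs /=; regs_eq.
  by rewrite /upper_addr; lia.
by rewrite /lower_addr; lia.
Qed.

Lemma runs_slices M Q : d = (n1 + n1)%N ->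
  I 0%N M ->
  (forall L' M', I (n * m * l)%N M' ->
    (exists r, size r = 10 /\ L' = header_regs (r ++ nseq 5 0)%N) -> Q L' M') ->
  runs slices_prog (header_regs (nseq 15 0%N)) M
    (6 + n * (8 + m * (8 + l * (7 + 2 * w)))) Q.
Proof.
move=> dE I0 h; rewrite /header_regs.
apply: (@runs_weaken _ _ _ (1 + (1 + (1 + (1 + (1 +
  (n * (7 + m * (8 + l * (7 + 2 * w))).+1).+1)))))%N); first by lia.
rewrite /slices_prog; do 10!step.
apply: (@runs_while _ _ _ (fun i L' M' => I (i * m * l)%N M' /\
  exists j0 q1 q2 k0 t1 t2 : nat, L' = slices_regs (i * m * l) i
    (upper_addr i 0 0) (lower_addr i 0 0) [:: j0; q1; q2; k0; t1; t2])).
- by move=> i ? ? [_ [? [? [? [? [? [? ->]]]]]]].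
- split; first by rewrite !mul0n.
  exists 0%N, 0%N, 0%N, 0%N, 0%N, 0%N.
  rewrite /slices_regs /header_regs /=; regs_eq.
    by rewrite /upper_addr; lia.
  by rewrite /lower_addr; lia.
- move=> i ? M' ltin [Ii [? [? [? [? [? [? ->]]]]]]].
  exact: runs_slab.
move=> ? M' [In [? [? [? [? [? [? ->]]]]]]]; apply: h => //.
by eexists; split; last reflexivity.
Qed.

Definition gadget_upper i := (base + ((l * N + i) * N + (n1 + i)))%N.
Definition gadget_lower i := (base + ((l * N + (n1 + i)) * N + i))%N.

Lemma runs_gadget r M (J : nat -> (nat -> F) -> Prop) Q : size r = 10 ->
  base = (l * NN)%N -> (sz 1 <= w)%N -> (sz (- 1) <= w)%N ->
  J 0%N M ->
  (forall i M', (i < n1)%N -> J i M' ->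
    J i.+1 (upd (upd M' (gadget_upper i) 1) (gadget_lower i) (- 1))) ->
  (forall L' M', J n1 M' -> nth 0%N L' 0 = N -> nth 0%N L' 1 = base ->
    Q L' M') ->
  runs gadget_prog (header_regs (r ++ nseq 5 0%N)) M (7 + n1 * (6 + 2 * w)) Q.
Proof.
move=> r10 baseE sz1 szN1 J0 stepJ h.
case: r r10 =>
  [|r1 [|r2 [|r3 [|r4 [|r5 [|r6 [|r7 [|r8 [|r9 [|r10 []]]]]]]]]]] // _.
rewrite /header_regs.
apply: (@runs_weaken _ _ _ (1 + (1 + (1 + (1 +
  ((n1 * (w.+1 + (w.+1 + (1 + (1 + 1)))).+1).+1 + (1 + 1))))))%N); first by lia.
rewrite /gadget_prog; do 9!step.
apply: (@runs_while _ _ _ (fun i L' M' => J i M' /\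
  L' = header_regs [:: r1; r2; r3; r4; r5; r6; r7; r8; r9; r10; 0%N; i;
    gadget_upper i; gadget_lower i; N.+1])).
- by move=> i ? ? [_ ->].
- split=> //; rewrite /header_regs /=; regs_eq.
    by rewrite /gadget_upper; lia.
  by rewrite /gadget_lower; lia.
- move=> i ? M' ltin [Ji ->]; rewrite /gadget_entry.
  step; apply: runs_fconst => //=; step; apply: runs_fconst => //=; do 5!step.
  split; first exact: stepJ.
  rewrite /header_regs; regs_eq.
    by rewrite /gadget_upper; lia.
  by rewrite /gadget_lower; lia.
move=> ? M' [Jn ->]; do 3!step.
by apply: h => //=; lia.
Qed.
End Registers.
End Programs.

(** * Row-major addressing *)

Section RowMajor.
Variable F : fieldType.

(** Written as the initial memory in [init], so that [row_major A] is that memory by conversion; it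
    also describes the output region. *)
Definition row_major (a b c : nat) (g : 'I_a * 'I_b * 'I_c -> F)
    (x : nat) : F :=
  if [pick p : 'I_a * 'I_b * 'I_c | ((p.1.1 * b + p.1.2) * c + p.2)%N == x]
  is Some p then g p else 0.

Lemma row_major_inj (b c i i' : nat) (j j' : 'I_b) (k k' : 'I_c) :
  ((i * b + j) * c + k = (i' * b + j') * c + k')%N ->
  [/\ i = i', j = j' & k = k'].
Proof.
have aux (e x x' : nat) (y y' : 'I_e) : (x * e + y = x' * e + y')%N ->
    x = x' /\ y = y'.
  move=> E; have e0 : (0 < e)%N by apply: leq_ltn_trans (ltn_ord y).
  have := congr1 (divn^~ e) E; rewrite !divnMDl // !divn_small // !addn0 => xE.
  by split=> //; apply: val_inj; move: E; rewrite /= xE => /addnI.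
by move=> /aux [/aux [-> ->] ->].
Qed.

Lemma row_majorE (a b c : nat) (g : 'I_a * 'I_b * 'I_c -> F) (i : 'I_a)
    (j : 'I_b) (k : 'I_c) :
  row_major g ((i * b + j) * c + k) = g (i, j, k).
Proof.
rewrite /row_major; case: pickP => [[[i' j'] k'] /eqP /= | /(_ (i, j, k))].
  by case/row_major_inj => /val_inj -> -> ->.
by rewrite eqxx.
Qed.

Lemma row_major_lt (a b c i j k : nat) :
  (i < a)%N -> (j < b)%N -> (k < c)%N -> ((i * b + j) * c + k < a * b * c)%N.
Proof.
move=> ia jb kc; have ij : (i * b + j < a * b)%N.
  apply: leq_trans (_ : i.+1 * b <= _)%N; last by rewrite leq_mul2r ia orbT.
  by rewrite mulSn addnC ltn_add2r.
apply: leq_trans (_ : (i * b + j).+1 * c <= _)%N.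
  by rewrite mulSn addnC ltn_add2r.
by rewrite leq_mul2r ij orbT.
Qed.

Lemma row_major_ge (a b c : nat) (g : 'I_a * 'I_b * 'I_c -> F) x :
  (a * b * c <= x)%N -> row_major g x = 0.
Proof.
move=> abcx; rewrite /row_major; case: pickP => // -[[i j] k] /eqP /= xE.
by move: abcx; rewrite leqNgt -xE row_major_lt.
Qed.

End RowMajor.

(** * Memory contents *)

Section Correctness.
Variables (F : fieldType) (n m l : nat) (A : array3 F n m l).
Local Notation d := (1 + n + (1 + n))%N.
Local Notation N := (d + m)%N.
Local Notation base := (l * (N * N))%N.

(** The intended final memory, input and output in one function. The program only ever stores
    [target y] at [y], so a correct cell stays correct under any write and addresses need not be
    shown distinct. *)
Definition target (x : nat) : F :=
  if (x < base)%N then row_major A x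
  else row_major (fun y : 'I_l.+1 * 'I_N * 'I_N => alt_mx A y.1.1 y.1.2 y.2)
         (x - base).

Lemma target_input x : (x < base)%N -> target x = row_major A x.
Proof. by rewrite /target => ->. Qed.

Lemma target_output (h : 'I_l.+1) (p q : 'I_N) :
  target (base + ((h * N + p) * N + q)) = alt_mx A h p q.
Proof. by rewrite /target ltnNge leq_addr /= addKn row_majorE. Qed.

(** [n] and [m] are at most [N], so the output, placed from [base] on, cannot overwrite the
    input. *)
Lemma input_lt_base : (n * m * l <= base)%N.
Proof.
rewrite mulnC leq_mul2l; apply/orP; right; apply: leq_mul.
  by rewrite -!addnA; lia.
exact: leq_addl.
Qed.

(** A cell still zero is already right for a zero entry of the output; the input region stays intact
    throughout. *)
Definition approx (M : nat -> F) : Prop :=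
  (forall x, M x = target x \/ M x = 0) /\
  (forall x, (x < base)%N -> M x = target x).

Lemma upd_target M x y :
  M x = target x -> upd M y (target y) x = target x.
Proof. by rewrite /upd; case: eqP => [->|]. Qed.

Lemma approx_upd M y : approx M -> approx (upd M y (target y)).
Proof.
case=> h1 h2; split=> x; last by move/h2/upd_target.
by rewrite /upd; case: eqP => [->|_]; [left | apply: h1].
Qed.

Lemma approx_init : approx (row_major A).
Proof.
split=> x; last by move/target_input ->.
have [/target_input ->|xge] := ltnP x base; first by left.
right; apply: row_major_ge; exact: leq_trans input_lt_base xge.
Qed.

Lemma approx_eq0 M (h : 'I_l.+1) (p q : 'I_N) : approx M ->
  alt_mx A h p q = 0 -> M (base + ((h * N + p) * N + q))%N = alt_mx A h p q.
Proof.
by case=> h1 _ E; have [->|->] := h1 (base + ((h * N + p) * N + q))%N;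
  rewrite ?target_output.
Qed.

Lemma mul_pad (S : 'M[F]_(n, m)) : pad F n *m S = col_mx (col_mx 0 S) 0.
Proof. by rewrite /pad !mul_col_mx !mul0mx mul1mx. Qed.

Lemma target_upper (i : 'I_n) (j : 'I_m) (k : 'I_l) :
  target (upper_addr d N base i j k) = A (i, j, k).
Proof.
have := target_output (widen_ord (leqnSn l) k)
  (lshift m (lshift (1 + n) (rshift 1 i))) (rshift d j).
rewrite /= alt_mx_slice block_mxEur mul_pad col_mxEu col_mxEd mxE.
exact.
Qed.

Lemma target_lower (i : 'I_n) (j : 'I_m) (k : 'I_l) :
  target (lower_addr d N base i j k) = - A (i, j, k).
Proof.
have := target_output (widen_ord (leqnSn l) k)
  (rshift d j) (lshift m (lshift (1 + n) (rshift 1 i))).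
rewrite /= alt_mx_slice block_mxEdl mul_pad mxE mxE col_mxEu col_mxEd mxE.
exact.
Qed.

Lemma target_gadget_upper i : (i < 1 + n)%N ->
  target (gadget_upper l (1 + n) N base i) = 1.
Proof.
move=> lti; pose o := Ordinal lti.
have := target_output ord_max (lshift m (lshift (1 + n) o))
  (lshift m (rshift (1 + n) o)).
by rewrite /= alt_mx_gadget block_mxEul block_mxEur mxE eqxx.
Qed.

Lemma target_gadget_lower i : (i < 1 + n)%N ->
  target (gadget_lower l (1 + n) N base i) = - 1.
Proof.
move=> lti; pose o := Ordinal lti.
have := target_output ord_max (lshift m (rshift (1 + n) o))
  (lshift m (lshift (1 + n) o)).
by rewrite /= alt_mx_gadget block_mxEul block_mxEdl !mxE eqxx.
Qed.

(** Zero entries come from [approx_eq0]; block by block, every nonzero entry sits at one of the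
    slice or gadget addresses. *)
Lemma approx_output M : approx M ->
  (forall (i : 'I_n) (j : 'I_m) (k : 'I_l),
     M (upper_addr d N base i j k) = A (i, j, k) /\
     M (lower_addr d N base i j k) = - A (i, j, k)) ->
  (forall i, (i < 1 + n)%N -> M (gadget_upper l (1 + n) N base i) = 1 /\
     M (gadget_lower l (1 + n) N base i) = - 1) ->
  forall (h : 'I_l.+1) (p q : 'I_N),
    M (base + ((h * N + p) * N + q))%N = alt_mx A h p q.
Proof.
move=> appr slicesE gadgetE h p q.
have [/eqP|] := boolP (alt_mx A h p q == 0); first exact: approx_eq0.
have [ltl|lel] := ltnP h l.
  rewrite (alt_mx_slice A (Ordinal ltl)) mul_pad.
  case: (split_ordP p) => p1 ->; case: (split_ordP q) => q1 ->.
  - by rewrite block_mxEul mxE eqxx.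
  - rewrite block_mxEur.
    case: (split_ordP p1) => p2 ->; last by rewrite col_mxEd mxE eqxx.
    case: (split_ordP p2) => p3 ->; first by rewrite col_mxEu col_mxEu mxE eqxx.
    rewrite col_mxEu col_mxEd mxE => _.
    by have [] := slicesE p3 q1 (Ordinal ltl).
  - rewrite block_mxEdl mxE mxE.
    case: (split_ordP q1) => q2 ->; last by rewrite col_mxEd mxE oppr0 eqxx.
    case: (split_ordP q2) => q3 ->.
      by rewrite col_mxEu col_mxEu mxE oppr0 eqxx.
    rewrite col_mxEu col_mxEd mxE => _.
    by have [] := slicesE q3 p1 (Ordinal ltl).
  - by rewrite block_mxEdr mxE eqxx.
have hl : h = l :> nat by apply/eqP; rewrite eqn_leq lel -ltnS ltn_ord.
rewrite hl alt_mx_gadget.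
case: (split_ordP p) => p1 ->; case: (split_ordP q) => q1 ->;
  rewrite ?block_mxEul ?block_mxEur ?block_mxEdl ?block_mxEdr;
  do ?by rewrite mxE eqxx.
case: (split_ordP p1) => p2 ->; case: (split_ordP q1) => q2 ->;
  rewrite ?block_mxEul ?block_mxEur ?block_mxEdl ?block_mxEdr;
  do ?by rewrite mxE eqxx.
- rewrite !mxE; case: (p2 =P q2) => [<- _|_]; last by rewrite eqxx.
  by have [] := gadgetE p2 (ltn_ord p2).
- rewrite !mxE; case: (p2 =P q2) => [<- _|_]; last by rewrite oppr0 eqxx.
  by have [] := gadgetE p2 (ltn_ord p2).
Qed.

End Correctness.

(** * Polynomial running time and the reduction theorem *)

(** Degree 4 comes from three nested loops of length at most [s0] around writes of cost linear in
    [s0]. *)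
Lemma polytime_alt_tuple (F : fieldType) (sz : F -> nat) :
  size_measure sz ->
  polytime_computable sz (fun n m l : nat => @alt_tuple F n m l).
Proof.
(* [C] covers growth under negation and the sizes of 1 and -1; the summand 1 ensures [s0 <= w]. *)
case=> c hc; pose C := (c + 1 + sz 1%R + sz (- 1)%R)%N.
(* 64 = 10 + 12 + 29 + 13: the header constant, three times [b6], then [b4] and [b5], which also
   contribute [2 * C] each. *)
exists (alt_prog F), (64 + 4 * C)%N, 4%N => n m l A.
set s0 := (input_size sz A).+1; pose w := (C * s0)%N.
set N := (1 + n + (1 + n) + m)%N; set d := (1 + n + (1 + n))%N in N *.
pose base := (l * (N * N))%N.
pose I q M := approx A M /\ forall (i : 'I_n) (j : 'I_m) (k : 'I_l),
  ((i * m + j) * l + k < q)%N ->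
  M (upper_addr d N base i j k) = target A (upper_addr d N base i j k) /\
  M (lower_addr d N base i j k) = target A (lower_addr d N base i j k).
pose J q M := I (n * m * l)%N M /\ forall i, (i < 1 + n)%N -> (i < q)%N ->
  M (gadget_upper l (1 + n) N base i) =
    target A (gadget_upper l (1 + n) N base i) /\
  M (gadget_lower l (1 + n) N base i) =
    target A (gadget_lower l (1 + n) N base i).
have Iupd q M x : I q M -> I q (upd M x (target A x)).
  case=> appr h; split; first exact: approx_upd.
  by move=> i j k lt; have [h1 h2] := h i j k lt; split; apply: upd_target.
have szA p : (sz (A p) < s0)%N.
  rewrite ltnS /input_size (bigD1 p) //=.
  exact: leq_trans (leq_addr _ _) (leq_addl _ _).
have szw x : (sz x < s0)%N -> (sz x <= w)%N /\ (sz (- x)%R <= w)%N.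
  move=> xs; split; first by rewrite (leq_trans (ltnW xs)) // /w /C; nia.
  have [_ h _ _] := hc x x; apply: leq_trans h _.
  by rewrite /w leq_mul // /C -!addnA leq_addr.
have copy_step i j k (a := ((i * m + j) * l + k)%N) M :
  (i < n)%N -> (j < m)%N -> (k < l)%N -> I a M ->
  let M' := upd M (upper_addr d N base i j k) (M a) in
  [/\ (sz (M a) <= w)%N, (sz (- M' a)%R <= w)%N
    & I a.+1 (upd M' (lower_addr d N base i j k) (- M' a))].
  move=> ltin ltjm ltkl IM.
  pose i' := Ordinal ltin; pose j' := Ordinal ltjm; pose k' := Ordinal ltkl.
  have alt : (a < base)%N.
    by apply: leq_trans (input_lt_base n m l); apply: row_major_lt.
  have Ma : M a = A (i', j', k').
    have [[_ ->]] := IM => //.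
    by rewrite target_input // (row_majorE A i' j' k').
  have upE : A (i', j', k') = target A (upper_addr d N base i j k).
    by rewrite -(target_upper A i' j' k').
  have loE : - A (i', j', k') = target A (lower_addr d N base i j k).
    by rewrite -(target_lower A i' j' k').
  (* Cell [a] survives the first write because that write stores a [target] value. *)
  move=> M'; have M'a : M' a = A (i', j', k').
    rewrite /M' Ma upE upd_target -?upE ?Ma //.
      by rewrite target_input // (row_majorE A i' j' k').
    by rewrite target_input // (row_majorE A i' j' k').
  have [sz1 sz2] := szw _ (szA (i', j', k')).
  split; rewrite ?Ma ?M'a //.
  have [appr old] : I a (upd M' (lower_addr d N base i j k) (- A (i', j', k'))).
    by rewrite loE /M' Ma upE; apply/Iupd/Iupd.
  split=> // i1 j1 k1; rewrite ltnS leq_eqVlt => /orP [/eqP|]; last exact: old.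
  case/(@row_major_inj m l i1 i j1 j' k1 k') => -> -> ->.
  split; last by rewrite /upd eqxx loE.
  rewrite loE; apply: upd_target.
  by rewrite /M' /upd eqxx Ma upE.
have total : runs sz (alt_prog F) ([:: n; m; l] ++ nseq 25 0%N) (row_major A)
    (10 + 3 * (N + l + (1 + n)) +
     (6 + n * (8 + m * (8 + l * (7 + 2 * w))) + (7 + (1 + n) * (6 + 2 * w))))
    (fun L M => [/\ nth 0%N L 0 = N, nth 0%N L 1 = base
                  & J (1 + n)%N M]).
  apply: runs_seq.
  apply: (@runs_header F sz n m l (1 + n) d N (N * N) base) => //.
  apply: runs_seq.
  apply: (@runs_slices F sz n m l (1 + n) d N (N * N) base w I) => //.
    by split; first exact: approx_init.
  move=> _ M IM [r [r10 ->]].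
  apply: (@runs_gadget F sz n m l (1 + n) d N (N * N) base w _ r M J) => //.
  - by rewrite /w /C; nia.
  - by rewrite /w /C; nia.
  - move=> i M' lti [IM' h].
    have := target_gadget_upper A lti; have := target_gadget_lower A lti.
    rewrite -/d -/N -/base => <- <-.
    split; first by apply/Iupd/Iupd.
    move=> i1 lti1; rewrite ltnS leq_eqVlt => /orP [/eqP ->|lt1].
      split; last by rewrite /upd eqxx.
      by apply: upd_target; rewrite /upd eqxx.
    by have [h1 h2] := h i1 lti1 lt1; split; apply/upd_target/upd_target.
have initL : nreg (init A) =1 nth 0%N ([:: n; m; l] ++ nseq 25 0%N).
  move=> x; rewrite nth_cat nth_nseq if_same.
  by case: x => [|[|[|x]]] //=; rewrite nth_nil.
have [t [s [L [ex tK sL [L0 L1 [[appr sliceE] gadgetE]]]]]] :=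
  total (init A) initL erefl.
exists t, s; split=> //.
  apply: leq_trans tK _.
  have nml : (n + m + l < s0)%N by rewrite ltnS /input_size leq_addr.
  (* One loop level: a length of at most [s0] raises the degree by one. *)
  have step k c0 c1 x y : (x <= s0)%N -> (y <= c1 * s0 ^ k)%N ->
      (c0 + x * y <= (c0 + c1) * s0 ^ k.+1)%N.
    move=> xs yK; rewrite mulnDl leq_add //; last first.
      by rewrite expnS mulnCA leq_mul.
    by rewrite leq_pmulr // expn_gt0.
  have pow k : (s0 ^ k <= s0 ^ 4)%N \/ (4 < k)%N.
    by case: (leqP k 4) => h; [left; rewrite leq_pexp2l | right].
  have [p1|//] := pow 1%N; have [p2|//] := pow 2%N; have [p0|//] := pow 0%N.
  have b1 : (7 + 2 * w <= (7 + 2 * C) * s0 ^ 1)%N.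
    by rewrite mulnDl expn1 /w -mulnA leq_add // leq_pmulr.
  have b1' : (6 + 2 * w <= (6 + 2 * C) * s0 ^ 1)%N.
    by rewrite mulnDl expn1 /w -mulnA leq_add // leq_pmulr.
  have b2 := step 1%N 8%N _ l _ ltac:(lia) b1.
  have b3 := step 2%N 8%N _ m _ ltac:(lia) b2.
  have b4 := step 3%N 6%N _ n _ ltac:(lia) b3.
  have b5 := step 1%N 7%N _ (1 + n)%N _ ltac:(lia) b1'.
  have b6 : (N + l + (1 + n) <= 4 * s0 ^ 1)%N by rewrite expn1 /N /d; lia.
  have b7 := leq_mul (leqnn (7 + (6 + 2 * C))) p2.
  rewrite expn0 in p0.
  move: (leq_add (leq_mul (leqnn 3) b6) (leq_add b4 (leq_trans b5 b7))) p1 p0.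
  move: (s0 ^ 1)%N (s0 ^ 4)%N (_ * (N + _ + _))%N (6 + _)%N (7 + _ * _)%N.
  clear; lia.
split; first by rewrite sL.
move=> h i j; rewrite sL L1 tnth_mktuple; apply: approx_output => //.
  move=> i1 j1 k1; rewrite -target_lower -target_upper; apply: sliceE.
  by apply: row_major_lt.
move=> i1 lti1.
rewrite -(target_gadget_lower A lti1) -(target_gadget_upper A lti1).
exact: gadgetE.
Qed.

Theorem theorem2p1 (F : fieldType) (sz : F -> nat) (hsz : size_measure sz) :
  exists (N : nat -> nat -> nat)
         (f : forall n m l : nat,
              array3 F n m l -> l.+1.-tuple 'M[F]_(N n m)),
    [/\ forall n m : nat, (N n m <= 3 * n + 2 * m + 2)%N,
        polytime_computable sz f,
        forall (n m l : nat) (A : array3 F n m l) (k : 'I_l.+1),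
          alternating (tnth (f n m l A) k)
      & forall (n m l : nat) (A B : array3 F n m l),
          tensor_iso A B <-> isometric <<f n m l A>>%VS <<f n m l B>>%VS].
Proof.
exists (fun n m => 1 + n + (1 + n) + m)%N, (fun n m l => @alt_tuple F n m l).
split.
- by move=> n m; lia.
- exact: polytime_alt_tuple.
- by move=> n m l A k; rewrite tnth_mktuple; apply: alternating_alt_mx.
move=> n m l A B; split; first exact: tensor_iso_isometric.
exact: isometric_tensor_iso.
Qed.
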